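(* Let $\Delta$ be a pure simplicial complex of dimension $m-1\ge2$ whose clique decomposition $\Delta=\Delta_1\cup\cdots\cup\Delta_r$ satisfies conditions (i) and (ii), and such that each clique $\Delta_i$ is a single $(m-1)$-simplex. Then: (a) if $\Delta$ is closed, then $J_\Delta$ is generated by a regular sequence; (b) for every finite simple graph $G$ and every integer $m\ge|V(G)|$ (with $m\ge 3$), there exists a closed pure $(m-1)$-dimensional simplicial complex $\Delta$ satisfying (i) and (ii), each of whose cliques is a single $(m-1)$-simplex, with $G_\Delta\cong G$; (c) if $\dim\Delta+1$ is greater than or equal to the number of facets of $\Delta$, then $\Delta$ is closed.
   Context: Let $K$ be a field, $X=(x_{ij})$ an $m\times n$ matrix of indeterminates, $S=K[X]$, and $\Delta$ a pure $(m-1)$-dimensional simplicial complex on $[n]$. For $1\le a_1<\dots<a_m\le n$, $[a_1\ldots a_m]$ is the maximal minor with columns $a_1,\dots,a_m$; $J_\Delta=(\mu_F : F\in\mathcal{F}(\Delta))$ with $\mu_F=[a_1\ldots a_m]$ for a facet $F=\{a_1<\dots<a_m\}$. Clique decomposition: let $\mathcal{S}$ be the set of simplices $\Gamma$ with vertices in $[n]$, $\dim\Gamma\ge m-1$, whose $(m-1)$-skeleton is contained in $\Delta$; the maximal elements $\Gamma_1,\dots,\Gamma_r$ of $\mathcal{S}$ give the cliques $\Delta_i=\Gamma_i^{(m-1)}$, $\Delta=\Delta_1\cup\cdots\cup\Delta_r$; $V(\Delta_i)$ is the vertex set of $\Delta_i$. Conditions: (i) $|V(\Delta_i)\cap V(\Delta_j)|\le1$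 for all $i<j$; (ii) $V(\Delta_i)\cap V(\Delta_j)\cap V(\Delta_k)=\emptyset$ for all $i<j<k$. $G_\Delta$ is the simple graph on vertices $v_1,\dots,v_r$ with an edge $\{v_i,v_j\}$ ($i\ne j$) iff $V(\Delta_i)\cap V(\Delta_j)\ne\emptyset$. $\Delta$ is closed with respect to a labeling of its vertices by $[n]$ if for any two facets $F=\{a_1<\dots<a_m\}$, $G=\{b_1<\dots<b_m\}$ with $a_i=b_i$ for some $i$, every $m$-subset of $F\cup G$ is a facet of $\Delta$; $\Delta$ is closed if some labeling makes it closed (in (a), $J_\Delta$ is formed with respect to such a labeling). *)

(* Defs.v *)
From HB Require Import structures.
From mathcomp Require Import all_boot all_order all_algebra all_fingroup.
Set Implicit Arguments. Unset Strict Implicit. Unset Printing Implicit Defensive.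
Import Order.TTheory GRing.Theory Num.Theory.
Local Open Scope ring_scope.

Fixpoint mpoly (R : idomainType) (k : nat) : idomainType :=
  if k is k'.+1 then ({poly mpoly R k'} : idomainType) else R.

(* the variable number i (0 <= i < k); the outermost variable has index k-1 *)
Fixpoint mvar (R : idomainType) (k : nat) (i : nat) : mpoly R k :=
  match k return mpoly R k with
  | 0 => 0
  | k'.+1 => if i == k' then ('X : {poly mpoly R k'}) else (mvar R k' i)%:P
  end.

(* S = K[X], X = (x_ij) an m x n matrix of indeterminates: x_ij = variable i*n+j *)
Definition SK (K : fieldType) (m n : nat) : idomainType := mpoly K (m * n)%N.
Definition xvar (K : fieldType) (m n : nat) (i j : nat) : SK K m n :=
  mvar K (m * n)%N (i * n + j)%N.

Definition in_ideal (R : comNzRingType) (s : seq R) (g : R) : Prop :=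
  exists c : nat -> R, g = \sum_(i < size s) c i * s`_i.

Definition regular_seq (R : comNzRingType) (s : seq R) : Prop :=
  ~ in_ideal s 1 /\
  forall i, (i < size s)%N ->
    forall g, in_ideal (take i s) (g * s`_i) -> in_ideal (take i s) g.

(* ---------- simplicial complexes, given by their facet sets on [n] = 'I_n *)
(* a_i of a facet F = {a_1 < ... < a_m}  (0-based index i) *)
Definition ith (n : nat) (F : {set 'I_n}) (i : nat) : nat :=
  nth 0%N [seq val x | x <- enum F] i.

Definition pure_dim (n m : nat) (D : {set {set 'I_n}}) : Prop :=
  D != set0 /\ forall F, F \in D -> #|F| = m.

Definition maxminor (K : fieldType) (m n : nat) (F : {set 'I_n}) : SK K m n :=
  \det (\matrix_(i < m, j < m) xvar K m n i (ith F j)).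

Definition J_gens (K : fieldType) (m n : nat) (D : {set {set 'I_n}}) : seq (SK K m n) :=
  [seq maxminor K m F | F <- enum D].

Definition gen_by_regular_seq (K : fieldType) (m n : nat) (D : {set {set 'I_n}}) : Prop :=
  exists s : seq (SK K m n), regular_seq s /\
    forall g, in_ideal s g <-> in_ideal (J_gens K m D) g.

Definition closed_lab (n m : nat) (D : {set {set 'I_n}}) : Prop :=
  forall F G, F \in D -> G \in D ->
    (exists2 i, (i < m)%N & ith F i = ith G i) ->
    forall H : {set 'I_n}, H \subset F :|: G -> #|H| = m -> H \in D.

Definition relabel (n : nat) (s : 'S_n) (D : {set {set 'I_n}}) : {set {set 'I_n}} :=
  [set (s @: F) | F : {set 'I_n} in D].

Definition closed_cx (n m : nat) (D : {set {set 'I_n}}) : Prop :=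
  exists s : 'S_n, closed_lab m (relabel s D).

(* Gamma (a simplex, given by its vertex set) has dim >= m-1 and its
   (m-1)-skeleton lies in Delta *)
Definition in_calS (n m : nat) (D : {set {set 'I_n}}) (Gam : {set 'I_n}) : bool :=
  (m <= #|Gam|)%N &&
  [forall H : {set 'I_n}, ((H \subset Gam) && (#|H| == m)) ==> (H \in D)].

(* the vertex sets V(Delta_i) = Gamma_i of the cliques *)
Definition cliques (n m : nat) (D : {set {set 'I_n}}) : {set {set 'I_n}} :=
  [set Gam | maxset (in_calS m D) Gam].

Definition cond_i (n m : nat) (D : {set {set 'I_n}}) : Prop :=
  forall A B, A \in cliques m D -> B \in cliques m D -> A != B ->
    (#|A :&: B| <= 1)%N.

Definition cond_ii (n m : nat) (D : {set {set 'I_n}}) : Prop :=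
  forall A B C, A \in cliques m D -> B \in cliques m D -> C \in cliques m D ->
    A != B -> A != C -> B != C -> A :&: B :&: C = set0.

Definition cliques_simplices (n m : nat) (D : {set {set 'I_n}}) : Prop :=
  forall A, A \in cliques m D -> #|A| = m.

Definition GDelta_iso (T : finType) (e : rel T) (n m : nat) (D : {set {set 'I_n}}) : Prop :=
  exists f : T -> {set 'I_n},
    injective f /\ (forall A, A \in cliques m D <-> exists x, A = f x) /\
    forall x y, e x y = (x != y) && (f x :&: f y != set0).

(* Main.v *)
(* If F <> G are facets sharing a vertex, some m-subset of their union other than F
   meets F in m-1 > 1 vertices; it cannot be a facet, as all cliques are facets and
   satisfy (i). So closedness says: distinct facets never have the same i-th vertex.

   (a) For the lexicographic order in which x_ij has rank i*n+j, the leading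
   monomial of a maximal minor is its diagonal term. By closedness the leading
   monomials of the generators are pairwise coprime, and polynomials with pairwise
   coprime leading monomials form a regular sequence: by induction on k, the
   leading monomial of any element of (f_1, ..., f_k) is divisible by one of the
   lm(f_j). Indeed, writing h = c + a f_k with c in (f_1, ..., f_(k-1)) and lm(a)
   divisible by no lm(f_j), j < k, no cancellation of leading terms can occur.

   (c) Give the facets numbers below m, and give the vertices of each facet F
   distinct slots below m such that a vertex shared with the facet number j gets
   slot j. Sort the vertices by the pair (facet number, slot) seen as a cell of a
   symmetric m x m table in row-major order: then a vertex is at position slot in
   each of its facets, so the vertex shared by the facets number i and j is at
   position j in the first one and i in the second one.

   (b) Glue the vertex (x, y) to (y, x) for each edge xy of G, and apply (c). *)

Require Import Defs.
From HB Require Import structures.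
From mathcomp Require Import all_boot all_order all_algebra all_fingroup.
Set Implicit Arguments. Unset Strict Implicit. Unset Printing Implicit Defensive.
Import GRing.Theory.
Local Open Scope ring_scope.

(** * The monomial order: comparison, totality and well-foundedness *)

(* Lexicographic order on exponent vectors, variable k-1 being the largest. *)
Fixpoint ltm (k : nat) (a b : nat -> nat) : bool :=
  if k is k'.+1 then (a k' < b k')%N || (a k' == b k') && ltm k' a b else false.

Lemma ltmP k a b :
  reflect (exists2 i, (i < k)%N & (a i < b i)%N /\
             forall j, (i < j < k)%N -> a j = b j) (ltm k a b).
Proof.
elim: k => [|k IH] /=; first by constructor; case.
apply: (iffP orP) => [[ltab | /andP[/eqP eqab /IH[i ltik [ltab eq_gt]]]] | [i]].
- by exists k => //; split=> // j /andP[kj]; rewrite ltnS leqNgt kj.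
- exists i; first exact: ltnW.
  split=> // j /andP[ij]; rewrite ltnS leq_eqVlt => /orP[/eqP->//|jk].
  by apply: eq_gt; rewrite ij.
rewrite ltnS leq_eqVlt => /orP[/eqP-> [] ltab _|ltik [ltab eq_gt]]; first by left.
right; rewrite eq_gt ?ltik ?ltnSn // eqxx /=; apply/IH; exists i => //.
by split=> // j /andP[ij jk]; apply: eq_gt; rewrite ij ltnW.
Qed.

Lemma ltm_total k a b :
  [\/ ltm k a b, ltm k b a | forall i, (i < k)%N -> a i = b i].
Proof.
elim: k => [|k IH] /=; first by constructor 3.
case: (ltngtP (a k) (b k)) => [_|_|eqab] /=; [by constructor 1 | by constructor 2 |].
case: IH => [->|->|eq_lt]; [by constructor 1 | by constructor 2 |].
by constructor 3 => i; rewrite ltnS leq_eqVlt => /orP[/eqP->//|/eq_lt].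
Qed.

Lemma ltm_wf k : well_founded (fun a b => ltm k a b).
Proof.
elim: k => [|k IH] a /=; first by constructor.
(* [d] bounds the top exponent: a smaller top exponent is handled by [IHd], a tie by accessibility
   in the lower variables. *)
move: {2}(a k).+1 (ltnSn (a k)) => d; elim: d a => [|d IHd] a; first by rewrite ltn0.
elim: (IH a) => {}a _ IHa; rewrite ltnS => le_ad.
constructor=> b /orP[lt_ba|/andP[/eqP eq_ba lt_ba]].
  by apply: IHd; apply: leq_trans le_ad.
by apply: IHa; rewrite ?eq_ba.
Qed.

(** * Leading monomials in iterated polynomial rings *)

Section LeadingMonomials.
Variable K : fieldType.

(* [mlead p a]: x^a is the leading monomial of p; [mlt p a]: all the monomials of
   p are less than x^a. Only the values of a on the k variables matter. *)
Fixpoint mlt (k : nat) : mpoly K k -> (nat -> nat) -> Prop :=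
  match k return mpoly K k -> (nat -> nat) -> Prop with
  | 0 => fun p _ => p = 0
  | k'.+1 => fun (p : {poly mpoly K k'}) a =>
      (size p <= (a k').+1)%N /\ mlt p`_(a k') a
  end.

Fixpoint mlead (k : nat) : mpoly K k -> (nat -> nat) -> Prop :=
  match k return mpoly K k -> (nat -> nat) -> Prop with
  | 0 => fun p _ => p != 0
  | k'.+1 => fun (p : {poly mpoly K k'}) a =>
      (size p <= (a k').+1)%N /\ mlead p`_(a k') a
  end.

Lemma mlead_neq0 k (p : mpoly K k) a : mlead p a -> p != 0.
Proof.
elim: k p => [|k IH] //= p [_ /IH]; apply: contraNneq => ->.
by rewrite coef0.
Qed.

(** The size bound in [mlead] is an equality because the coefficient it singles out is nonzero; this
    gives access to the size and leading coefficient of products. *)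
Lemma mleadS k (p : {poly mpoly K k}) a :
  @mlead k.+1 p a <-> size p = (a k).+1 /\ mlead (lead_coef p) a.
Proof.
split=> [/= [le_p lead_p]|[sz_p lead_p]]; last first.
  by split; rewrite ?sz_p //; rewrite /lead_coef sz_p in lead_p.
have sz_p : size p = (a k).+1.
  apply/eqP; rewrite eqn_leq le_p /= ltnNge; apply: contra (mlead_neq0 lead_p).
  by move=> ?; rewrite nth_default.
by rewrite /lead_coef sz_p.
Qed.

Lemma mlead_ext k (p : mpoly K k) a b :
  (forall i, (i < k)%N -> a i = b i) -> mlead p a -> mlead p b.
Proof.
elim: k p => [|k IH] //= p eq_ab; rewrite -eq_ab // => -[le_p lead_p]; split=> //.
by apply: IH lead_p => i lt_ik; apply: eq_ab; apply: ltnW.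
Qed.

Lemma ex_mlead k (p : mpoly K k) : p != 0 -> exists a, mlead p a.
Proof.
elim: k p => [|k IH] p p0; first by exists (fun=> 0%N).
have /IH[a lead_p] : lead_coef (p : {poly mpoly K k}) != 0 by rewrite lead_coef_eq0.
exists (fun i => if i == k then (size (p : {poly mpoly K k})).-1 else a i).
rewrite /= eqxx -/(lead_coef _) leqSpred; split=> //.
by apply: mlead_ext lead_p => i; case: eqP => // ->; rewrite ltnn.
Qed.

Lemma mleadN k (p : mpoly K k) a : mlead p a -> mlead (- p) a.
Proof.
elim: k p => [|k IH] /= p; first by rewrite oppr_eq0.
by rewrite size_polyN coefN => -[le_p /IH].
Qed.

Lemma mlead1 k : mlead (1 : mpoly K k) (fun=> 0%N).
Proof.
elim: k => [|k IH] /=; first exact: oner_neq0.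
by rewrite size_poly1 coef1.
Qed.

Lemma mleadM k (p q : mpoly K k) a b :
  mlead p a -> mlead q b -> mlead (p * q) (fun i => (a i + b i)%N).
Proof.
elim: k p q => [|k IH] p q; first exact: mulf_neq0.
move=> lead_p lead_q; have [p0 q0] := (mlead_neq0 lead_p, mlead_neq0 lead_q).
move/mleadS: lead_p => [sz_p lead_p]; move/mleadS: lead_q => [sz_q lead_q].
apply/mleadS; rewrite lead_coefM (size_mul p0 q0) sz_p sz_q /=.
by split; [rewrite addnS | exact: IH].
Qed.

Lemma mlead_prod k (I : Type) (r : seq I) (F : I -> mpoly K k) a :
  (forall i, mlead (F i) (a i)) ->
  mlead (\prod_(i <- r) F i) (fun v => (\sum_(i <- r) a i v)%N).
Proof.
move=> leadF; elim: r => [|i r IH].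
  by rewrite big_nil; apply: mlead_ext (mlead1 k) => v; rewrite big_nil.
rewrite big_cons; apply: mlead_ext (mleadM (leadF i) IH) => v _.
by rewrite big_cons.
Qed.

Lemma mlead_mvar k i : (i < k)%N -> mlead (mvar K k i) (fun v => (v == i : nat)).
Proof.
elim: k => [|k IH] //= lt_ik; have [->|ne_ik] := eqVneq i k.
  rewrite size_polyX coefX; split=> //.
  by apply: mlead_ext (mlead1 k) => v; case: ltngtP.
rewrite size_polyC_leq1 coefC; split=> //.
by apply: IH; rewrite ltn_neqAle ne_ik.
Qed.

Lemma mlt0 k a : mlt (0 : mpoly K k) a.
Proof. by elim: k => [|k IH] //=; rewrite size_poly0 coef0. Qed.

Lemma mltD k (p q : mpoly K k) a : mlt p a -> mlt q a -> mlt (p + q) a.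
Proof.
elim: k p q => [|k IH] /= p q; first by move=> -> ->; rewrite addr0.
move=> [le_p lt_p] [le_q lt_q]; split; last by rewrite coefD; apply: IH.
by rewrite (leq_trans (size_polyD _ _)) // geq_max le_p.
Qed.

Lemma mleadD k (p q : mpoly K k) a : mlead p a -> mlt q a -> mlead (p + q) a.
Proof.
elim: k p q => [|k IH] /= p q; first by move=> ? ->; rewrite addr0.
move=> [le_p lt_p] [le_q lt_q]; split; last by rewrite coefD; apply: IH.
by rewrite (leq_trans (size_polyD _ _)) // geq_max le_p.
Qed.

Lemma mlead_mlt k (p : mpoly K k) a b : mlead p a -> ltm k a b -> mlt p b.
Proof.
elim: k p => [|k IH] //= p [le_p lead_p] /orP[lt_ab|/andP[/eqP eq_ab lt_ab]].
  split; first by rewrite (leq_trans le_p) // ltnW.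
  by rewrite nth_default ?(leq_trans le_p) //; apply: mlt0.
by rewrite -eq_ab; split=> //; apply: IH lead_p lt_ab.
Qed.

Lemma mlt_mlead k (p : mpoly K k) a b : mlt p b -> mlead p a -> ltm k a b.
Proof.
elim: k p => [|k IH] p; first by move=> -> /eqP.
move=> [le_p lt_p] /mleadS [sz_p lead_p].
move: le_p lead_p; rewrite sz_p ltnS leq_eqVlt /lead_coef sz_p /= => /orP[/eqP eq_ab|-> //].
by rewrite eq_ab eqxx => lead_p; rewrite (IH _ lt_p lead_p) orbT.
Qed.

Lemma mlead_uniq k (p : mpoly K k) a b :
  mlead p a -> mlead p b -> forall i, (i < k)%N -> a i = b i.
Proof.
elim: k p => [|k IH] p // /mleadS[sz_a lead_a] /mleadS[].
rewrite sz_a => -[eq_ab] lead_b i; rewrite ltnS leq_eqVlt => /orP[/eqP->//|].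
exact: IH lead_a lead_b i.
Qed.

Lemma mlead_cancel k (p q : mpoly K k) a b :
  mlead p a -> mlead q b -> (forall i, (i < k)%N -> (b i <= a i)%N) ->
  exists c : mpoly K k, mlt (p - c * q) a.
Proof.
elim: k p q => [|k IH] p q.
  by move=> p0 q0 _; exists (p / q); rewrite /= divfK ?subrr.
move=> [le_p lead_p] [le_q lead_q] le_ba.
have [i lt_ik|c lt_c] := IH _ _ lead_p lead_q; first by apply: le_ba; apply: ltnW.
(* The multiplier for the lower variables, times the missing power of the top one. *)
exists (c%:P * 'X^(a k - b k) : {poly mpoly K k}); split.
  rewrite (leq_trans (size_polyD _ _)) // geq_max le_p size_polyN /=.
  rewrite -mulrA mul_polyC (leq_trans (size_scale_leq _ _)) //.
  apply/leq_sizeP => j lt_aj; rewrite coefXnM; case: ltnP => // le_j.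
  rewrite nth_default // (leq_trans le_q) // -(leq_add2r (a k - b k)) subnK //.
  by rewrite addSn subnKC ?le_ba.
rewrite coefB -mulrA coefCM coefXnM ltnNge leq_subr /= subKn //; exact: le_ba.
Qed.

(** * Division and regularity for pairwise coprime leading monomials *)

Section CoprimeLeads.
Variables (k r : nat) (f : nat -> mpoly K k) (L : nat -> nat -> nat).
Hypothesis leadf : forall i, (i < r)%N -> mlead (f i) (L i).
Hypothesis coprimeL : forall i j v, (i < j)%N -> (j < r)%N -> (v < k)%N ->
  L i v = 0%N \/ L j v = 0%N.

(** Coefficients are functions on [nat], so one family [c] serves for every [i] in inductions. *)
Definition span i (g : mpoly K k) := exists c, g = \sum_(j < i) c (nat_of_ord j) * f j.

Lemma span0 i : span i 0.
Proof. by exists (fun=> 0); rewrite big1 // => j _; rewrite mul0r. Qed.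

Lemma spanD i g h : span i g -> span i h -> span i (g + h).
Proof.
move=> [c ->] [d ->]; exists (fun j => c j + d j); rewrite -big_split /=.
by apply: eq_bigr => j _; rewrite mulrDl.
Qed.

Lemma spanM i g h : span i h -> span i (g * h).
Proof.
move=> [c ->]; exists (fun j => g * c j); rewrite mulr_sumr.
by apply: eq_bigr => j _; rewrite mulrA.
Qed.

Lemma span_gen i j : (j < i)%N -> span i (f j).
Proof.
move=> lt_ji; exists (fun j' => (j' == j)%:R).
rewrite (bigD1 (Ordinal lt_ji)) //= eqxx mul1r big1 ?addr0 // => j'.
by rewrite -val_eqE /= => /negPf->; rewrite mul0r.
Qed.

Definition divm (a b : nat -> nat) := [forall v : 'I_k, a v <= b v]%N.

(** Coprimality: wherever [L j] is nonzero, [L i] vanishes and contributes nothing. *)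
Lemma divm_add j i b : (j < i)%N -> (i < r)%N ->
  divm (L j) (fun v => b v + L i v)%N -> divm (L j) b.
Proof.
move=> lt_ji lt_ir /forallP dv; apply/forallP => v; have := dv v.
by case: (coprimeL lt_ji lt_ir (ltn_ord v)) => ->; rewrite ?addn0.
Qed.

(** Division with remainder, by well-founded induction on the leading monomial. It stops as soon as
    the leading monomial is irreducible; lower monomials of the remainder are unconstrained. *)
Lemma lead_reduction i g : (i <= r)%N -> exists g',
  span i (g - g') /\
  (g' = 0 \/ exists2 b, mlead g' b & forall j, (j < i)%N -> ~~ divm (L j) b).
Proof.
move=> le_ir; have [->|] := eqVneq g 0.
  by exists 0; split; [rewrite subrr; apply: span0 | left].
move/ex_mlead=> [a]; elim: (ltm_wf k a) g => {}a _ IH g lead_g.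
have [/existsP[j dvd_j]|no_dvd] := boolP [exists j : 'I_i, divm (L j) a]; last first.
  exists g; split; first by rewrite subrr; apply: span0.
  right; exists a => // j lt_ji; apply: contra no_dvd => dvd_j.
  by apply/existsP; exists (Ordinal lt_ji).
have lt_jr : (j < r)%N by apply: leq_trans le_ir.
have [v lt_vk|c lt_c] := mlead_cancel lead_g (leadf lt_jr).
  exact: (forallP dvd_j (Ordinal lt_vk)).
have span_c : span i (c * f j) by apply: spanM; apply: span_gen.
have [eq0|] := eqVneq (g - c * f j) 0.
  exists 0; split; last by left.
  by move/eqP: eq0; rewrite subr0 subr_eq0 => /eqP->.
move/ex_mlead=> [b lead_b].
have [g' [span_g' red_g']] := IH b (mlt_mlead lt_c lead_b) _ lead_b.
exists g'; split=> //; have := spanD span_g' span_c.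
by rewrite addrAC subrK.
Qed.

Lemma mlead_span i h b : (i <= r)%N -> span i h -> mlead h b ->
  exists2 j, (j < i)%N & divm (L j) b.
Proof.
elim: i h b => [|i IH] h b lt_ir.
  by move=> [c]; rewrite big_ord0 => -> /mlead_neq0; rewrite eqxx.
move=> [c]; rewrite big_ord_recr /= => def_h lead_h.
have [g' [span_g' red_g']] := lead_reduction (c i) (ltnW lt_ir).
set c0 := \sum_(j < i) _ in def_h.
(* Replacing the coefficient of [f i] by its remainder [g'] moves a multiple of [f i * (c i - g')]
   into the span of the earlier generators. *)
pose c' := c0 + f i * (c i - g').
have span_c' : span i c' by apply: spanD; [exists c | apply: spanM].
have {}def_h : h = c' + g' * f i.
  by rewrite def_h /c' -addrA (mulrC (f i)) -mulrDl subrK.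
case: red_g' => [g'0 | [b' lead_g' red_g']].
  rewrite def_h g'0 mul0r addr0 in lead_h.
  by have [j lt_ji dvd_j] := IH _ _ (ltnW lt_ir) span_c' lead_h; exists j => //; apply: ltnW.
have lead_gf := mleadM lead_g' (leadf lt_ir).
have last_dvd : mlead h (fun v => b' v + L i v)%N ->
    exists2 j, (j < i.+1)%N & divm (L j) b.
  move=> lead_h'; exists i => //; apply/forallP => v.
  by rewrite (mlead_uniq lead_h lead_h') // leq_addl.
have [c'0|] := eqVneq c' 0; first by apply: last_dvd; rewrite def_h c'0 add0r.
move/ex_mlead=> [d lead_c'].
have [j lt_ji dvd_j] := IH _ _ (ltnW lt_ir) span_c' lead_c'.
(* The larger of the leading monomials of [c'] and [g' * f i] is that of [h]. A tie is impossible: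
   some [L j] would divide the leading monomial of [g' * f i], hence by coprimality that of [g']. *)
have [lt_d|gt_d|eq_d] := ltm_total k d (fun v => b' v + L i v)%N.
- apply: last_dvd; rewrite def_h addrC; apply: mleadD lead_gf _.
  exact: mlead_mlt lead_c' lt_d.
- exists j; first exact: ltnW.
  have lead_h' : mlead h d.
    by rewrite def_h; apply: mleadD lead_c' _; apply: mlead_mlt lead_gf gt_d.
  apply/forallP => v; rewrite (mlead_uniq lead_h lead_h') //; exact: (forallP dvd_j).
case/negP: (red_g' j lt_ji); apply: divm_add lt_ji lt_ir _.
by apply/forallP => v; rewrite -eq_d //; exact: (forallP dvd_j).
Qed.

(** A nonzero remainder [g'] of [g] would put [g' * f i] in the span, so some [L j] with [j < i]
    would divide its leading monomial, hence that of [g']. *)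
Lemma span_regular i g : (i < r)%N -> span i (g * f i) -> span i g.
Proof.
move=> lt_ir span_gf; have [g' [span_g' red_g']] := lead_reduction g (ltnW lt_ir).
case: red_g' => [g'0|[b lead_g' red_g']]; first by rewrite g'0 subr0 in span_g'.
have span_gf' : span i (g' * f i).
  have := spanD span_gf (spanM (- f i) span_g').
  by rewrite mulNr mulrBr opprB mulrC addrC subrK mulrC.
have [j lt_ji] := mlead_span (ltnW lt_ir) span_gf' (mleadM lead_g' (leadf lt_ir)).
by move/(divm_add lt_ji lt_ir); rewrite (negPf (red_g' j lt_ji)).
Qed.

End CoprimeLeads.

Lemma coprime_leads_regular k (s : seq (mpoly K k)) (L : nat -> nat -> nat) :
  (forall i, (i < size s)%N -> mlead s`_i (L i)) ->
  (forall i, (i < size s)%N -> exists2 v, (v < k)%N & L i v != 0%N) ->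
  (forall i j v, (i < j)%N -> (j < size s)%N -> (v < k)%N ->
     L i v = 0%N \/ L j v = 0%N) ->
  regular_seq s.
Proof.
move=> lead_s L_neq0 coprimeL; split.
  (* The leading exponent of 1 is zero, so it is divisible by no nonconstant [L j]: the ideal is
     proper. *)
  move=> one_s; have [j lt_j /forallP dvd_j] :=
    mlead_span lead_s coprimeL (leqnn _) one_s (mlead1 k).
  by have [v lt_vk] := L_neq0 j lt_j; rewrite -leqn0 (dvd_j (Ordinal lt_vk)).
move=> i lt_i g.
have spanE h : in_ideal (take i s) h <-> span (nth 0 s) i h.
  rewrite /in_ideal /span size_takel 1?ltnW //.
  by split=> -[c ->]; exists c; apply: eq_bigr => j _; rewrite nth_take.
by move/spanE/(span_regular lead_s coprimeL lt_i)/spanE.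
Qed.

End LeadingMonomials.

(** * Vertex positions and diagonal terms of maximal minors *)

Lemma sorted_vals n (F : {set 'I_n}) : sorted ltn [seq val x | x <- enum F].
Proof.
rewrite sorted_map /enum_mem; apply: sorted_filter.
  by move=> x y z /=; apply: ltn_trans.
by have := iota_ltn_sorted 0 n; rewrite -val_enum_ord sorted_map /enum_mem filter_predT.
Qed.

Lemma ith_ltn n (F : {set 'I_n}) i j : (i < j < #|F|)%N -> (ith F i < ith F j)%N.
Proof.
case/andP=> lt_ij lt_j.
apply: (sorted_ltn_nth ltn_trans 0%N (sorted_vals F)) => //; rewrite inE size_map -cardE //.
exact: ltn_trans lt_j.
Qed.

(** Describing a position by the number of smaller vertices turns later statements about relabeled
    facets into cardinality counts. *)
Lemma ithP n (F : {set 'I_n}) i : (i < #|F|)%N ->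
  exists2 w : 'I_n, w \in F & ith F i = w /\ i = #|[set u in F | (u < w)%N]|.
Proof.
move=> lt_i; have lt_i' : (i < size (enum F))%N by rewrite -cardE.
have [w0 _] : exists w, w \in F by apply/card_gt0P; apply: leq_ltn_trans lt_i.
pose w := nth w0 (enum F) i; have ith_w : ith F i = w by rewrite /ith (nth_map w0).
exists w; first by rewrite -mem_enum mem_nth.
split=> //; have sz : (i < size [seq val x | x <- enum F])%N by rewrite size_map.
have := Order.POrderTheory.count_lt_nth 0%N (sorted_vals F) sz.
rewrite -/(ith F i) ith_w count_map => {1}<-.
rewrite -size_filter cardE; apply: perm_size; apply: uniq_perm.
- by rewrite filter_uniq ?enum_uniq.
- exact: enum_uniq.
by move=> u; rewrite mem_filter !mem_enum !inE /= andbC.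
Qed.

Section DiagonalTerm.
Variables (K : fieldType) (m n : nat).

(** Row [i'] occupies the block of indices from [i' * n] to [i' * n + n - 1], so only the summand of
    row [i] can be nonzero. *)
Lemma sum_index_eq (f : 'I_m -> nat) (i : 'I_m) (j : nat) :
  (forall i', f i' < n)%N -> (j < n)%N ->
  (\sum_(i' < m) (i * n + j == i' * n + f i' : nat))%N = (f i == j : nat).
Proof.
move=> lt_f lt_j; rewrite (bigD1 i) //= eqn_add2l [j == _]eq_sym.
rewrite big1 ?addn0 // => i'; rewrite -val_eqE /= => ne_i.
case: eqP => // /(congr1 (divn^~ n)).
have n_gt0 := leq_ltn_trans (leq0n _) lt_j.
by rewrite !divnMDl // !divn_small // !addn0 => eq_i; rewrite eq_i eqxx in ne_i.
Qed.

Lemma mlead_maxminor (F : {set 'I_n}) : #|F| = m ->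
  @mlead K (m * n)%N (maxminor K m F) (fun v => ith F (v %/ n) == v %% n)%N.
Proof.
move=> cardF.
have lt_ith (i : 'I_m) : (ith F i < n)%N.
  by have [|w _ [-> _]] := @ithP n F i; rewrite ?cardF.
have divmodP v : (v < m * n)%N ->
    exists2 i : 'I_m, val i = (v %/ n)%N & v = (i * n + v %% n)%N /\ (v %% n < n)%N.
  move=> lt_v; have n_gt0 : (0 < n)%N by case: (n) lt_v; rewrite ?muln0.
  have lt_i : (v %/ n < m)%N by rewrite ltn_divLR.
  by exists (Ordinal lt_i) => //; rewrite -divn_eq ltn_mod.
(* Exponent vector of the term of the determinant given by [s]. *)
pose E (s : 'S_m) v := (\sum_(i < m) (v == i * n + ith F (s i) : nat))%N.
have evalE (s : 'S_m) (i : 'I_m) j : (j < n)%N ->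
    E s (i * n + j)%N = (ith F (s i) == j).
  by move=> lt_j; rewrite /E (sum_index_eq (f := fun i => ith F (s i))).
have leadE (s : 'S_m) : @mlead K (m * n)%N
    (\prod_i (\matrix_(i < m, j < m) xvar K m n i (ith F j)) i (s i)) (E s).
  apply: mlead_prod => i; rewrite mxE; apply: mlead_mvar.
  rewrite (@leq_trans (i * n + n)) ?ltn_add2l // addnC -mulSn leq_mul2r.
  by rewrite ltn_ord orbT.
have E1 v : (v < m * n)%N -> E 1%g v = (ith F (v %/ n) == v %% n)%N.
  move=> lt_v; have [i def_i [def_v lt_j]] := divmodP v lt_v.
  by rewrite {1}def_v evalE // perm1 def_i.
refine (mlead_ext E1 _). rewrite /maxminor /determinant (bigD1 1%g) //=.
apply: mleadD; first by rewrite odd_perm1 expr0 mul1r.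
apply: (big_ind (fun p : mpoly K (m * n)%N => mlt p (E 1%g))) => [|p q|s s_neq1].
- exact: mlt0.
- exact: mltD.
apply: (@mlead_mlt _ _ _ (E s)); first by rewrite mulr_sign; case: ifP => _ //; apply: mleadN.
have [i0 si0] : exists i, s i != i.
  apply/existsP; apply: contraNT s_neq1; rewrite negb_exists => /forallP fix_s.
  by apply/eqP/permP=> i; rewrite perm1; apply/eqP; rewrite -[_ == _]negbK.
(* Take the last row [i] moved by [s]. All later rows are fixed, so [s i < i]. *)
case: (arg_maxnP (P := fun i => s i != i) val si0) => i si max_i.
have fix_s (j : 'I_m) : (i < j)%N -> s j = j.
  by move=> lt_ij; apply: contraTeq lt_ij => /max_i /=; rewrite -leqNgt.
have lt_si : (s i < i)%N.
  rewrite ltn_neqAle si leqNgt; apply: contra si => lt_is.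
  by apply/eqP; apply: (@perm_inj _ s); apply: fix_s.
(* The diagonal variable of row [i] decides: it occurs for the identity and not for [s]. Later rows
   agree, and further right in row [i] neither term has a variable. *)
apply/ltmP; exists (i * n + ith F i)%N.
  rewrite (@leq_trans (i * n + n)) ?ltn_add2l // addnC -mulSn leq_mul2r.
  by rewrite ltn_ord orbT.
have lt_i := ltn_ord i.
split.
  rewrite !evalE // perm1 eqxx.
  by rewrite [_ == _]ltn_eqF // ith_ltn // lt_si cardF.
move=> v /andP[lt_iv lt_v]; have [j def_j [def_v lt_r]] := divmodP v lt_v.
rewrite def_v !evalE // perm1.
case: (ltngtP i j) => [lt_ij|gt_ij|/val_inj eq_ij].
- by rewrite fix_s.
- move: lt_iv; rewrite ltnNge def_v (@leq_trans (j.+1 * n)) //.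
    by rewrite mulSn addnC leq_add2r ltnW.
  by rewrite (leq_trans _ (leq_addr _ _)) // leq_mul2r gt_ij orbT.
move: lt_iv; rewrite {1}def_v -eq_ij ltn_add2l => lt_F.
rewrite [ith F i == _]ltn_eqF // [_ == _]ltn_eqF //.
by rewrite (ltn_trans _ lt_F) // ith_ltn // lt_si cardF.
Qed.

End DiagonalTerm.

(** Facets with no common [i]-th vertex have diagonal terms without a common variable. *)
Lemma J_gens_regular (K : fieldType) (m n : nat) (D : {set {set 'I_n}}) :
  (0 < m)%N -> (forall F, F \in D -> #|F| = m) ->
  (forall F G, F \in D -> G \in D -> F != G ->
     forall i, (i < m)%N -> ith F i != ith G i) ->
  regular_seq (J_gens K m D).
Proof.
move=> m_gt0 cardD distinct; pose F i := nth set0 (enum D) i.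
have memF i : (i < size (J_gens K m D))%N -> F i \in D.
  by rewrite size_map => lt_i; rewrite -mem_enum mem_nth.
apply: (@coprime_leads_regular K (m * n)%N _
  (fun i v => ith (F i) (v %/ n) == v %% n)%N).
- move=> i lt_i; rewrite /J_gens (nth_map set0) -?/(F i); last by rewrite size_map in lt_i.
  by apply: mlead_maxminor; apply: cardD; apply: memF.
- move=> i /memF Fi; have [|w _ [def_w _]] := @ithP n (F i) 0; first by rewrite cardD.
  exists (val w); last by rewrite divn_small ?ltn_ord // modn_small ?ltn_ord // def_w eqxx.
  by rewrite (leq_trans (ltn_ord w)) // leq_pmull.
move=> i j v lt_ij lt_j lt_v; have lt_i := ltn_trans lt_ij lt_j.
have ne_F : F i != F j.
  rewrite /F nth_uniq ?enum_uniq ?ltn_eqF //; by rewrite size_map in lt_i lt_j.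
have n_gt0 : (0 < n)%N by case: (n) lt_v; rewrite ?muln0.
have lt_row : (v %/ n < m)%N by rewrite ltn_divLR.
have := distinct _ _ (memF i lt_i) (memF j lt_j) ne_F _ lt_row.
have [->|] := eqVneq (ith (F i) (v %/ n)) (v %% n)%N; last by left.
by rewrite eq_sym => /negPf->; right.
Qed.

Local Open Scope nat_scope.

(** * Facets, cliques and closedness *)

Section Facets.
Variables (n m : nat) (D : {set {set 'I_n}}).
Hypothesis cardD : forall F, F \in D -> #|F| = m.

Lemma in_calS_card A : in_calS m D A -> #|A| = m -> A \in D.
Proof.
case/andP=> _ /forallP/(_ A) + cardA.
by rewrite subxx cardA eqxx.
Qed.

Lemma facet_in_calS F : F \in D -> in_calS m D F.
Proof.
move=> FD; rewrite /in_calS cardD // leqnn; apply/forallP => H; apply/implyP.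
case/andP=> sHF /eqP cardH; suff -> : H = F by [].
by apply/eqP; rewrite eqEcard sHF cardH cardD /=.
Qed.

Lemma cliques_eq : cliques_simplices m D -> cliques m D = D.
Proof.
move=> simplD; apply/setP => F; apply/idP/idP => FD.
  apply: in_calS_card (simplD _ FD); by move: FD; rewrite inE => /maxsetp.
have [A maxA sFA] := maxset_exists (facet_in_calS FD).
have cardA : #|A| = m by apply: simplD; rewrite inE.
suff -> : F = A by rewrite inE.
by apply/eqP; rewrite eqEcard sFA cardA cardD /=.
Qed.

Hypothesis m_ge3 : 3 <= m.
Hypothesis meetD : forall F G, F \in D -> G \in D -> F != G -> #|F :&: G| <= 1.

(** A larger clique would contain [m.+1] vertices; removing two different ones in turn yields two
    facets with [m - 1 > 1] common vertices. *)
Lemma meet_cliques_simplices : cliques_simplices m D.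
Proof.
move=> A; rewrite inE => /maxsetp /andP[le_mA /forallP subA].
apply/eqP; rewrite eqn_leq le_mA andbT leqNgt; apply/negP => lt_mA.
have in_D x (B : {set 'I_n}) : B \subset A -> #|B| = m.+1 -> x \in B -> B :\ x \in D.
  move=> sBA; rewrite (cardsD1 x) => + Bx; rewrite Bx add1n => -[cardB].
  by apply: (implyP (subA _)); rewrite cardB eqxx (subset_trans (subsetDl _ _)).
have [B /andP[sBA /eqP cardB]] : exists B : {set 'I_n}, (B \subset A) && (#|B| == m.+1).
  have : 0 < 'C(#|A|, m.+1) by rewrite bin_gt0.
  by rewrite -cards_draws => /card_gt0P[B]; rewrite inE; exists B.
have [x Bx] : exists x, x \in B by apply/card_gt0P; rewrite cardB.
have card1 : #|B :\ x| = m by move: cardB; rewrite (cardsD1 x) Bx add1n => -[].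
have [y] : exists y, y \in B :\ x by apply/card_gt0P; rewrite card1; apply: leq_trans m_ge3.
rewrite !inE => /andP[ne_yx By].
have card2 : (#|B :\ x :\ y|).+1 = m by rewrite -card1 (cardsD1 y (B :\ x)) !inE ne_yx By.
have ne_xy : B :\ x != B :\ y.
  by apply/eqP=> /setP/(_ x); rewrite !inE eqxx Bx eq_sym ne_yx.
have := meetD (in_D x B sBA cardB Bx) (in_D y B sBA cardB By) ne_xy.
have -> : (B :\ x) :&: (B :\ y) = B :\ x :\ y.
  by apply/setP=> z; rewrite !inE; case: (z \in B); rewrite ?andbF ?andbT // andbC.
by rewrite leqNgt -ltnS card2 m_ge3.
Qed.

Lemma closed_ith_neq : closed_lab m D ->
  forall F G, F \in D -> G \in D -> F != G ->
  forall i, i < m -> ith F i != ith G i.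
Proof.
move=> closedD F G FD GD neFG i lt_im; apply/eqP=> eq_ith.
have cardF := cardD FD; have cardG := cardD GD.
have [y Gy Fy] : exists2 y, y \in G & y \notin F.
  by apply/subsetPn; apply: contra neFG => sGF; rewrite eq_sym eqEcard sGF cardF cardG /=.
have [x Fx] : exists x, x \in F by apply/card_gt0P; rewrite cardF; apply: leq_trans m_ge3.
have card1 : (#|F :\ x|).+1 = m by rewrite -cardF (cardsD1 x F) Fx.
(* Closedness makes a facet of [F] with [x] exchanged for [y]; it shares [m - 1 > 1] vertices with
   [F]. *)
have HD : y |: (F :\ x) \in D.
  apply: (closedD F G) => //; first by exists i.
    rewrite subUset sub1set inE Gy orbT /=.
    by rewrite (subset_trans (subsetDl _ _)) // subsetUl.
  by rewrite cardsU1 !inE (negPf Fy) andbF.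
have ne_HF : y |: (F :\ x) != F by apply: contraNneq Fy => <-; rewrite setU11.
have sub_meet : F :\ x \subset (y |: (F :\ x)) :&: F.
  by rewrite subsetI subsetUr subsetDl.
have := leq_trans (subset_leq_card sub_meet) (meetD HD FD ne_HF).
by rewrite leqNgt -ltnS card1 m_ge3.
Qed.

End Facets.

(** Closedness then only concerns [F = G], whose sole [m]-subset is [F] itself. *)
Lemma ith_neq_closed n m (D : {set {set 'I_n}}) :
  (forall F, F \in D -> #|F| = m) ->
  (forall F G, F \in D -> G \in D -> F != G ->
     forall i, i < m -> ith F i != ith G i) ->
  closed_lab m D.
Proof.
move=> cardD distinct F G FD GD [i lt_im eq_ith] H sHFG cardH.
have [eqFG|neFG] := eqVneq F G; last first.
  by have := distinct F G FD GD neFG i lt_im; rewrite eq_ith eqxx.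
rewrite -eqFG setUid in sHFG; suff -> : H = F by [].
by apply/eqP; rewrite eqEcard sHFG cardH cardD /=.
Qed.

(** * Closed labelings of complexes with few facets *)

Lemma ex_sorting_perm n (key : 'I_n -> nat) :
  exists s : 'S_n, forall u v, key u < key v -> s u < s v.
Proof.
(* Ties are broken by the vertex itself, which makes the rank injective. *)
pose key' (v : 'I_n) := key v * n + v.
have lt_key' u v : key u < key v -> key' u < key' v.
  move=> lt_uv; apply: leq_trans (leq_addr _ _).
  rewrite (@leq_trans ((key u).+1 * n)) ?leq_mul2r ?lt_uv ?orbT //.
  by rewrite /key' mulSn [n + _]addnC ltn_add2l.
have inj_key' : injective key'.
  move=> u v eq_uv; apply: val_inj; move: eq_uv; have [/lt_key'|/lt_key'|] := ltngtP (key u) (key v).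
  - by rewrite ltn_neqAle => /andP[/eqP].
  - by rewrite ltn_neqAle => /andP[/eqP H _] /esym.
  by rewrite /key' => -> /addnI.
pose below v := [set u | key' u < key' v].
have lt_below v : #|below v| < n.
  rewrite -[X in _ < X]card_ord -cardsT; apply: proper_card; rewrite properT.
  by apply/eqP=> /setP/(_ v); rewrite !inE ltnn.
pose s v := Ordinal (lt_below v).
have lt_s u v : key' u < key' v -> s u < s v.
  move=> lt_uv; apply: proper_card; apply/properP; split.
    by apply/subsetP => w; rewrite !inE => /ltn_trans; apply.
  by exists u; rewrite !inE ?ltnn.
have inj_s : injective s.
  move=> u v /(congr1 val) /= eq_uv; apply: inj_key'.
  by case: (ltngtP (key' u) (key' v)) => // /lt_s; rewrite /= eq_uv ltnn.
by exists (perm inj_s) => u v /lt_key'/lt_s; rewrite !permE.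
Qed.

Lemma extend_injection (T U : finType) (A B : {set T}) (f : T -> U) :
  B \subset A -> #|A| <= #|U| -> {in B &, injective f} ->
  exists g : T -> U, {in A &, injective g} /\ {in B, g =1 f}.
Proof.
move=> sBA leAU injf; pose C := A :\: B; pose E := ~: (f @: B).
have leCE : #|C| <= #|E|.
  rewrite cardsD (setIidPr sBA) -(leq_add2l #|f @: B|) cardsC.
  by rewrite card_in_imset // subnKC // subset_leq_card.
(* Outside [B], match the elements of [A] in order with values missed by [f] on [B]; by [idxC] the
   default of [nth] is never reached on [A]. *)
pose g x := if x \in B then f x else nth (f x) (enum E) (index x (enum C)).
have idxC x : x \in A -> x \notin B -> index x (enum C) < size (enum E).
  move=> Ax Bx; rewrite -cardE; apply: leq_trans leCE.
  by rewrite cardE index_mem mem_enum inE Ax Bx.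
have gE x : x \in A -> x \notin B -> g x \in E.
  by move=> Ax Bx; rewrite /g (negPf Bx) -mem_enum mem_nth // idxC.
exists g; split; last by move=> x Bx; rewrite /g Bx.
move=> x y Ax Ay.
have [[Bx|Bx] [By|By]] := (boolP (x \in B), boolP (y \in B)).
- by rewrite /g Bx By; apply: injf.
- move=> eq_g; have := gE y Ay By; rewrite -eq_g /g Bx inE.
  by rewrite imset_f.
- move=> eq_g; have := gE x Ax Bx; rewrite eq_g /g By inE.
  by rewrite imset_f.
rewrite /g (negPf Bx) (negPf By) (set_nth_default (f x) (f y)) ?idxC //.
move/eqP; rewrite nth_uniq ?enum_uniq ?idxC // => /eqP eq_idx.
have Cx : x \in enum C by rewrite mem_enum inE Ax Bx.
by rewrite -(nth_index x Cx) eq_idx nth_index // mem_enum inE Ay By.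
Qed.

Lemma card_ord_lt m x : x <= m -> #|[set j : 'I_m | j < x]| = x.
Proof.
move=> le_xm; rewrite -sum1_card (eq_bigl (fun j : 'I_m => j < x)) => [|j]; last by rewrite inE.
by rewrite (big_ord_narrow le_xm) sum1_card card_ord.
Qed.

(* Rank of the cell {a, b} of the symmetric table, in row-major order on a <= b. *)
Definition cell_key m (a b : nat) := minn a b * m + maxn a b.

Lemma cell_keyC m a b : cell_key m a b = cell_key m b a.
Proof. by rewrite /cell_key minnC maxnC. Qed.

(** The cells containing [k] run down column [k] to the diagonal and then along row [k]; row-major
    order increases along this path. *)
Lemma ltn_cell_key m k a b : k < m -> a < b < m -> cell_key m k a < cell_key m k b.
Proof.
move=> lt_km /andP[lt_ab lt_bm]; rewrite /cell_key; case: (leqP k a) => [le_ka|lt_ak].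
  have le_kb := leq_trans le_ka (ltnW lt_ab).
  by rewrite (minn_idPl le_kb) (maxn_idPr le_kb) ltn_add2l.
apply: (@leq_trans (a.+1 * m)); first by rewrite mulSn addnC ltn_add2r.
by rewrite (leq_trans _ (leq_addr _ _)) // leq_mul2r leq_min lt_ak lt_ab orbT.
Qed.

Lemma closed_of_few_facets n m (D : {set {set 'I_n}}) :
  0 < m -> (forall F, F \in D -> #|F| = m) ->
  (forall F G, F \in D -> G \in D -> F != G -> #|F :&: G| <= 1) ->
  (forall F G H, F \in D -> G \in D -> H \in D ->
     F != G -> F != H -> G != H -> F :&: G :&: H = set0) ->
  #|D| <= m -> closed_cx m D.
Proof.
move=> m_gt0 cardD meetD tripleD leDm.
(* Number of a facet; the default can occur only outside [D]. *)
pose rk F : 'I_m := insubd (Ordinal m_gt0) (index F (enum D)).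
have rk_inj : {in D &, injective rk}.
  have ltD F : F \in D -> index F (enum D) < m.
    by move=> FD; apply: leq_trans leDm; rewrite cardE index_mem mem_enum.
  move=> F G FD GD /(congr1 val); rewrite !val_insubd !ltD // => eq_idx.
  have FD' : F \in enum D by rewrite mem_enum.
  by rewrite -(nth_index F FD') eq_idx nth_index // mem_enum.
have meet_eq F G u v : F \in D -> G \in D -> F != G ->
    u \in F :&: G -> v \in F :&: G -> u = v.
  by move=> FD GD neFG uFG vFG; have /card_le1_eqP := meetD F G FD GD neFG; apply.
have two_facets F G H v : F \in D -> G \in D -> H \in D -> F != G -> F != H ->
    v \in F -> v \in G -> v \in H -> G = H.
  move=> FD GD HD neFG neFH Fv Gv Hv; apply/eqP; apply: contraT => neGH.
  by have /setP/(_ v) := tripleD F G H FD GD HD neFG neFH neGH; rewrite !inE Fv Gv Hv.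
(* The membership premise sits under the existential so that finite choice applies to all sets at
   once. *)
have ex_slot F : exists sl : 'I_n -> 'I_m, F \in D ->
    {in F &, injective sl} /\
    forall G v, G \in D -> F != G -> v \in F -> v \in G -> sl v = rk G.
  have [FD|_] := boolP (F \in D); last by exists (fun=> Ordinal m_gt0).
  pose other v := [pick G in D | (F != G) && (v \in G)].
  pose B := [set v in F | other v].
  have otherP v : v \in B -> exists G, [/\ other v = Some G, G \in D, F != G & v \in F :&: G].
    rewrite !inE => /andP[Fv]; rewrite /other; case: pickP => //= G /and3P[GD neFG Gv] _.
    by exists G; rewrite !inE Fv Gv.
  pose f v := if other v is Some G then rk G else Ordinal m_gt0.
  (* Two vertices with the same prescribed slot lie in the same other facet, hence coincide by
     (i). *)
  have injf : {in B &, injective f}.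
    move=> u v /otherP[G [def_u GD neFG Fu]] /otherP[H [def_v HD _ Fv]].
    rewrite /f def_u def_v => /(rk_inj _ _ GD HD) eqGH; rewrite -eqGH in Fv.
    exact: meet_eq Fu Fv.
  have [||sl [inj_sl eq_sl]] := @extend_injection _ _ F B f _ _ injf.
  - by apply/subsetP => v; rewrite inE => /andP[].
  - by rewrite cardD // card_ord.
  exists sl => _; split=> // G v GD neFG Fv Gv.
  have Bv : v \in B.
    by rewrite inE Fv /other; case: pickP => //= /(_ G); rewrite GD neFG Gv.
  rewrite eq_sl // /f; have [H [-> HD neFH /setIP[_ Hv]]] := otherP v Bv.
  by rewrite (two_facets F G H v).
have [sl slP] := fin_all_exists ex_slot.
pose key v := if [pick F in D | v \in F] is Some F then cell_key m (rk F) (sl F v) else 0.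
(* The facet picked is irrelevant: a vertex shared by [F] and [G] has the cell of [rk F] and [rk G]
   from either side, and the table is symmetric. *)
have keyE F v : F \in D -> v \in F -> key v = cell_key m (rk F) (sl F v).
  move=> FD Fv; rewrite /key; case: pickP => [G /andP[GD Gv]|/(_ F)]; last by rewrite FD Fv.
  have [->//|neFG] := eqVneq F G; have [_ slF] := slP F FD; have [_ slG] := slP G GD.
  by rewrite (slF G) // (slG F) 1?eq_sym // cell_keyC.
have [s s_mono] := ex_sorting_perm key.
exists s; apply: ith_neq_closed.
  by move=> _ /imsetP[F FD ->]; rewrite card_imset ?cardD //; apply: perm_inj.
(* On [F] the slots form a bijection onto ['I_m], and [s] sorts the vertices by slot. *)
have position F v : F \in D -> v \in F ->
    #|[set w in s @: F | w < s v]| = sl F v.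
  move=> FD Fv; have [inj_sl _] := slP F FD.
  have sl_mono u w : u \in F -> w \in F -> sl F u < sl F w -> s u < s w.
    by move=> Fu Fw lt_uw; apply: s_mono; rewrite !(keyE F) // ltn_cell_key // lt_uw /=.
  rewrite -[RHS](@card_ord_lt m) 1?ltnW //.
  have -> : [set j : 'I_m | j < sl F v] = sl F @: [set u in F | s u < s v].
    have slF : sl F @: F = setT.
      by apply/eqP; rewrite eqEcard subsetT cardsT card_ord card_in_imset // cardD /=.
    apply/setP=> j; have /imsetP[u Fu ->] : j \in sl F @: F by rewrite slF inE.
    rewrite inE; apply/idP/imsetP => [lt_uv|[w]].
      by exists u; rewrite // inE Fu sl_mono.
    rewrite inE => /andP[Fw lt_wv] eq_sl; rewrite (inj_sl _ _ Fu Fw eq_sl) ltnNge.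
    apply: contraL lt_wv; rewrite leq_eqVlt => /orP[/eqP/val_inj eq_vw|lt_vw].
      by rewrite (inj_sl _ _ Fv Fw eq_vw) ltnn.
    by rewrite -leqNgt ltnW // sl_mono.
  rewrite [RHS]card_in_imset => [|u w]; last first.
    by rewrite !inE => /andP[Fu _] /andP[Fw _]; apply: inj_sl.
  rewrite -[RHS](card_imset _ (@perm_inj _ s)); apply: eq_card => w; rewrite inE; apply/andP/imsetP => [[/imsetP[u Fu ->] lt_uv]|[u]].
    by exists u; rewrite // inE Fu.
  by rewrite inE => /andP[Fu lt_uv] ->; rewrite imset_f.
(* A common vertex at the same position in both facets would have slot [rk G] in [F] and [rk F] in
   [G], forcing [F = G]. *)
move=> _ _ /imsetP[F FD ->] /imsetP[G GD ->] neFG i lt_im; apply/eqP => eq_ith.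
have {}neFG : F != G by apply: contraNneq neFG => ->.
have cards H : H \in D -> #|s @: H| = m.
  by move=> HD; rewrite card_imset ?cardD //; apply: perm_inj.
have [|w /imsetP[v Fv ->] [ith_v pos_v]] := @ithP n (s @: F) i; first by rewrite cards.
have [|w' /imsetP[v' Gv' ->] [ith_v' pos_v']] := @ithP n (s @: G) i; first by rewrite cards.
have eq_v : v = v'.
  by apply: (@perm_inj _ s); apply: val_inj; rewrite /= -ith_v -ith_v' eq_ith.
rewrite -eq_v in Gv' pos_v'.
rewrite position // in pos_v; rewrite position // in pos_v'.
have [_ slF] := slP F FD; have [_ slG] := slP G GD.
have : rk G = rk F.
  by rewrite -(slF G v) // -(slG F v) 1?eq_sym //; apply: val_inj; rewrite /= -pos_v.
by move/(rk_inj _ _ GD FD) => eqGF; rewrite eqGF eqxx in neFG.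
Qed.

(** * Realizing a graph by gluing simplices *)

Lemma ex_closed_realization (T : finType) (e : rel T) (m : nat) :
  symmetric e -> irreflexive e -> 0 < #|T| -> #|T| <= m -> 2 < m ->
  exists (n : nat) (D : {set {set 'I_n}}),
    pure_dim m D /\ closed_cx m D /\ cond_i m D /\ cond_ii m D /\
    cliques_simplices m D /\ GDelta_iso e m D.
Proof.
move=> e_sym e_irr T_gt0 leTm m_ge3.
(* Each graph vertex reserves one slot in every facet; this is where [#|T| <= m] enters. *)
pose slot (x : T) : 'I_m := widen_ord leTm (enum_rank x).
have slot_inj : injective slot.
  by move=> x y /(congr1 val) /= /val_inj /enum_rank_inj.
(* Slot y of the facet of x is glued to slot x of the facet of y when e x y. *)
pose glue (x : T) (j : 'I_m) : T * 'I_m :=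
  if [pick y | [&& e x y, slot y == j & slot y < slot x]] is Some y then (y, slot x) else (x, j).
have glue_edge x y : e x y -> slot y < slot x -> glue x (slot y) = (y, slot x).
  move=> exy lt_yx; rewrite /glue; case: pickP => [z /and3P[_ /eqP/slot_inj -> //]|/(_ y)].
  by rewrite exy eqxx lt_yx.
have glueP x j : glue x j = (x, j) \/
    exists y, [/\ e x y, slot y = j, slot y < slot x & glue x j = (y, slot x)].
  rewrite /glue; case: pickP => [y /and3P[exy /eqP eq_j lt_yx]|_]; last by left.
  by right; exists y.
have glue_meet x y i j : glue x i = glue y j -> x = y /\ i = j \/ e x y /\ i = slot y /\ j = slot x.
  case: (glueP x i) => [->|[z [exz <- lt_zx ->]]];
    case: (glueP y j) => [->|[w [eyw <- lt_wy ->]]] => -[].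
  - by move=> -> ->; left.
  - by move=> -> ->; right; rewrite e_sym.
  - by move=> <- <-; right.
  by move=> -> /val_inj/enum_rank_inj ->; left.
(* The ground set is all of [T * 'I_m]; a pair replaced by its glued partner lies in no facet. *)
pose F x := [set enum_rank (glue x j) | j : 'I_m].
have cardF x : #|F x| = m.
  rewrite card_imset ?card_ord // => i j /enum_rank_inj /glue_meet[[]//|[]].
  by rewrite e_irr.
have F_meet x y v : x != y -> v \in F x -> v \in F y ->
    e x y /\ v = enum_rank (glue x (slot y)).
  move=> ne_xy /imsetP[i _ ->] /imsetP[j _ /enum_rank_inj /glue_meet[[eq_xy]|]].
    by rewrite eq_xy eqxx in ne_xy.
  by move=> [exy [-> _]].
have glueC x y : e x y -> glue x (slot y) = glue y (slot x).
  have glue_small a b : e a b -> slot a < slot b -> glue a (slot b) = (a, slot b).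
    move=> eab lt_ab; case: (glueP a (slot b)) => [//|[z [_ /slot_inj -> lt_ba _]]].
    by have := ltn_trans lt_ab lt_ba; rewrite ltnn.
  move=> exy; have eyx : e y x by rewrite e_sym.
  have [lt_xy|lt_yx|/val_inj/slot_inj eq_xy] := ltngtP (slot x) (slot y).
  - by rewrite glue_small // glue_edge.
  - by rewrite glue_edge // glue_small.
  by rewrite eq_xy.
have meetF x y : x != y -> #|F x :&: F y| <= 1.
  move=> ne_xy; apply/card_le1_eqP => u v /setIP[Fxu Fyu] /setIP[Fxv Fyv].
  by have [[_ ->] [_ ->]] := (F_meet x y u ne_xy Fxu Fyu, F_meet x y v ne_xy Fxv Fyv).
have F_inj : injective F.
  move=> x y eqF; apply/eqP; apply: contraT => /meetF.
  by rewrite eqF setIid cardF leqNgt (ltn_trans _ m_ge3).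
pose D := [set F x | x : T].
have cardD A : A \in D -> #|A| = m by case/imsetP=> x _ ->.
have meetD A B : A \in D -> B \in D -> A != B -> #|A :&: B| <= 1.
  move=> /imsetP[x _ ->] /imsetP[y _ ->] neF; apply: meetF.
  by apply: contraNneq neF => ->.
have tripleD A B C : A \in D -> B \in D -> C \in D ->
    A != B -> A != C -> B != C -> A :&: B :&: C = set0.
  move=> /imsetP[x _ ->] /imsetP[y _ ->] /imsetP[z _ ->] neXY neXZ neYZ.
  have [nexy nexz neyz] : [/\ x != y, x != z & y != z].
    by split; [move: neXY | move: neXZ | move: neYZ]; apply: contraNneq => ->.
  apply/setP=> v; rewrite !inE; apply/negP => /andP[/andP[Fx Fy] Fz].
  (* Within [F x], a vertex shared with [F y] is the one in slot [y], so it cannot also be shared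
     with a third facet. *)
  have [_ def_v] := F_meet x y v nexy Fx Fy.
  have [_] := F_meet x z v nexz Fx Fz.
  rewrite {1}def_v => /enum_rank_inj/glue_meet[[_ /slot_inj eq_yz]|[]].
    by rewrite eq_yz eqxx in neyz.
  by rewrite e_irr.
have simplD := meet_cliques_simplices m_ge3 meetD.
have cliqD := cliques_eq cardD simplD.
exists #|{: T * 'I_m}|, D; split; [|split; [|split; [|split; [|split=> //]]]].
- split=> //; have /card_gt0P[x _] := T_gt0.
  by apply/set0Pn; exists (F x); apply: imset_f.
- apply: closed_of_few_facets => //; first exact: ltn_trans m_ge3.
  by rewrite card_imset.
- by rewrite /cond_i cliqD.
- by rewrite /cond_ii cliqD.
exists F; split=> //; split.
  by move=> A; rewrite cliqD; split=> [/imsetP[x _ ->]|[x ->]]; [exists x | apply: imset_f].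
move=> x y; apply/idP/andP => [exy|[ne_xy /set0Pn[v /setIP[Fxv Fyv]]]]; last first.
  by have [] := F_meet x y v ne_xy Fxv Fyv.
split; first by apply: contraTneq exy => ->; rewrite e_irr.
apply/set0Pn; exists (enum_rank (glue x (slot y))).
by apply/setIP; split; [|rewrite glueC //]; apply: imset_f.
Qed.

Theorem theorem3p4 :
  (* (a) *)
  (forall (K : fieldType) (m n : nat) (D : {set {set 'I_n}}),
     (3 <= m)%N -> pure_dim m D -> cond_i m D -> cond_ii m D ->
     cliques_simplices m D -> closed_lab m D ->
     gen_by_regular_seq K m D)
  /\
  (* (b) *)
  (forall (T : finType) (e : rel T) (m : nat),
     symmetric e -> irreflexive e -> (0 < #|T|)%N ->
     (#|T| <= m)%N -> (3 <= m)%N ->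
     exists (n : nat) (D : {set {set 'I_n}}),
       pure_dim m D /\ closed_cx m D /\ cond_i m D /\ cond_ii m D /\
       cliques_simplices m D /\ GDelta_iso e m D)
  /\
  (* (c) *)
  (forall (m n : nat) (D : {set {set 'I_n}}),
     (3 <= m)%N -> pure_dim m D -> cond_i m D -> cond_ii m D ->
     cliques_simplices m D -> (#|D| <= m)%N -> closed_cx m D).
Proof.
split; [|split].
- move=> K m n D m_ge3 [_ cardD] condi _ simplD closedD.
  exists (J_gens K m D); split=> //.
  apply: J_gens_regular; [exact: ltn_trans m_ge3 | exact: cardD |].
  apply: closed_ith_neq => //.
  by move: condi; rewrite /cond_i cliques_eq.
- exact: ex_closed_realization.
move=> m n D m_ge3 [_ cardD] condi condii simplD leDm.
have cliqD := cliques_eq cardD simplD; rewrite /cond_i /cond_ii cliqD in condi condii.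
apply: closed_of_few_facets => //; exact: ltn_trans m_ge3.
Qed.
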